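(* Let $k\ge 2$, $n\ge 1$ be integers, let $p\in\Delta^{k-1}$, and let $\hat p_{k,n}$ be the empirical probability vector of a multinomial sample with $n$ trials and probability vector $p$. For every $t>0$, $$\mathbb{P}\left(n\,\mathcal{D}(\hat p_{k,n}\|p)>t\right)\le\min_{\lambda\in[0,1]}\exp(-\lambda t)\,G_{k,n}(\lambda).$$
   Context: $\Delta^{k-1}=\{p\in\mathbb{R}^k: p_i\ge 0,\ \sum_{i=1}^k p_i=1\}$. If $(X_1,\dots,X_k)$ is multinomial with $n$ trials and probability vector $p$, then $\hat p_{k,n}=(X_1/n,\dots,X_k/n)$. The relative entropy is $\mathcal{D}(\hat p\|p)=\sum_{i=1}^k\hat p_i\log(\hat p_i/p_i)$ with natural logarithm and conventions $0\cdot\log(0)=0$, $0\cdot\log(0/0)=0$. For integers $k,n\ge1$, $p\in\Delta^{k-1}$ and $\lambda\in[0,1]$, $$G_{k,n}(\lambda,p):=\sum_{X_1,\dots,X_k}\binom{n}{X_1,\dots,X_k}\prod_{i=1}^k\left[\lambda X_i/n+(1-\lambda)p_i\right]^{X_i},$$ where the sum is over non-negative integers with $X_1+\dots+X_k=n$, and $0^0=1$. This value does not depend on $p\in\Delta^{k-1}$; the common value is denoted $G_{k,n}(\lambda)$, and it is a polynomial in $\lambda$. *)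

(* Defs.v *)
From HB Require Import structures.
From mathcomp Require Import all_boot all_order all_algebra.
From mathcomp Require Import all_classical all_reals all_analysis.
From mathcomp Require Import ring.

Set Implicit Arguments.
Unset Strict Implicit.
Unset Printing Implicit Defensive.

Import Order.TTheory GRing.Theory Num.Theory.

Local Open Scope classical_set_scope.
Local Open Scope ring_scope.

Definition simplex (R : realType) (k : nat) : set ('I_k -> R) :=
  [set p | (forall i, 0 <= p i) /\ \sum_i p i = 1].

(* The multinomial coefficient, as a real number; only used when
   \sum_i x i = n. *)
Definition multinom (R : realType) (k n : nat) (x : 'I_k -> nat) : R :=
  n`!%:R / \prod_i (x i)`!%:R.

Definition multinomial_pmf (R : realType) (k n : nat) (p : 'I_k -> R)
    (x : 'I_k -> nat) : R :=
  if (\sum_i x i == n)%N then multinom R n x * \prod_i p i ^+ x i else 0.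

Definition is_multinomial d (T : measurableType d) (R : realType)
    (P : probability T R) (k n : nat) (p : 'I_k -> R)
    (X : 'I_k -> {RV P >-> nat}) : Prop :=
  forall x : 'I_k -> nat,
    P [set w | forall i, X i w = x i] = (multinomial_pmf n p x)%:E.

Definition empirical (R : realType) (k n : nat) (x : 'I_k -> nat) : 'I_k -> R :=
  fun i => (x i)%:R / n%:R.

(* Extended-real arithmetic supplies the conventions: 0^-1 = +oo,
   lne 0 = -oo and 0 * -oo = 0, so a term with q i = 0 vanishes, whereas
   q i > 0 = p i gives +oo; see rel_entropy_term below. *)
Definition rel_entropy (R : realType) (k : nat) (q p : 'I_k -> R) : \bar R :=
  (\sum_i (q i)%:E * lne ((q i)%:E / (p i)%:E))%E.

Lemma rel_entropy_term (R : realType) (a b : R) : 0 <= a -> 0 <= b ->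
  (a%:E * lne (a%:E / b%:E))%E =
  if a == 0 then 0%E else if b == 0 then +oo%E else (a * ln (a / b))%:E.
Proof.
move=> a0 b0; have [->|an0] := eqVneq a 0; first by rewrite mul0e.
have {an0}a0 : 0 < a by rewrite lt_neqAle eq_sym an0.
have [->|bn0] := eqVneq b 0.
  by rewrite inver eqxx gt0_muley ?lte_fin//= gt0_muley ?lte_fin.
have {bn0}b0 : 0 < b by rewrite lt_neqAle eq_sym bn0.
by rewrite inver gt_eqF// -EFinM lne_EFin ?divr_gt0// -EFinM.
Qed.

(* The index set is that of all k-tuples of naturals with sum n; each entry
   of such a tuple is at most n, whence the finite type 'I_n.+1. *)
Definition Gsum (R : realType) (k n : nat) (lam : R) (p : 'I_k -> R) : R :=
  \sum_(x : {ffun 'I_k -> 'I_n.+1} | (\sum_i x i == n)%N)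
    multinom R n (fun i => x i) *
    \prod_i (lam * ((x i)%:R / n%:R) + (1 - lam) * p i) ^+ x i.

(* The common value of Gsum k n lam on the simplex, evaluated at the uniform
   probability vector; the choice of vector is immaterial by GsumE below. *)
Definition G (R : realType) (k n : nat) (lam : R) : R :=
  Gsum n lam (fun _ : 'I_k => k%:R^-1).
Arguments G {R} k n lam.

Section GsumE.
Variable R : realType.

(* Up to the change of variables in Gsum_H this is Gsum; H_indep is the
   Abel-Hurwitz fact that it depends on y only through \sum_i y i: along a
   segment with constant total, the derivative in direction i is n times the
   sum for n - 1 with y i increased by a, and induction on n applies. *)
Local Definition H (k n : nat) (a : R) (y : 'I_k -> R) : R :=
  \sum_(x : {ffun 'I_k -> 'I_n.+1} | (\sum_i x i == n)%N)
    multinom R n (fun i => x i) * \prod_i (a * (x i)%:R + y i) ^+ x i.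

Local Lemma le_total2 k n (x : 'I_k -> nat) i j : j != i ->
  (\sum_i x i == n)%N -> (x i + x j <= n)%N.
Proof.
by move=> ji /eqP <-; rewrite (bigD1 i)//= (bigD1 j)//= addnA leq_addr.
Qed.

Local Lemma shift_total k (x : 'I_k -> nat) i :
  (\sum_j (x j + (j == i)) = (\sum_j x j).+1)%N.
Proof.
rewrite big_split/= -addn1; congr (_ + _)%N.
by rewrite (bigD1 i)//= eqxx big1// => j /negbTE ->.
Qed.

Local Lemma multinom_shift k n (x : 'I_k -> nat) i :
  multinom R n.+1 (fun j => (x j + (j == i))%N) * (x i).+1%:R =
  n.+1%:R * multinom R n x.
Proof.
rewrite /multinom (bigD1 i)//= [in RHS](bigD1 i)//= eqxx addn1.
rewrite (eq_bigr (fun j => (x j)`!%:R)); last first.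
  by move=> j /negbTE ->; rewrite addn0.
rewrite !factS !natrM.
have h j : (x j)`!%:R != 0 :> R by rewrite pnatr_eq0 -lt0n fact_gt0.
have hP : \prod_(j < k | j != i) (x j)`!%:R != 0 :> R.
  by apply/prodf_neq0 => j _.
have h1 : (x i).+1%:R != 0 :> R by rewrite pnatr_eq0.
move: (h i) hP h1; move: (\prod_(j < k | _) _) (n`!%:R) (n.+1%:R).
move: ((x i)`!%:R) ((x i).+1%:R) => u v w r s u0 w0 v0.
by field; rewrite u0 w0 v0.
Qed.

Local Lemma H_shift k n (a : R) (y : 'I_k -> R) i :
  \sum_(x : {ffun 'I_k -> 'I_n.+2} | (\sum_i x i == n.+1)%N)
    multinom R n.+1 (fun i => x i) *
      (((a * (x i)%:R + y i) ^+ (x i).-1 *+ x i) *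
       \prod_(j | j != i) (a * (x j)%:R + y j) ^+ x j) =
  n.+1%:R * H n a (fun j => y j + a * (j == i)%:R).
Proof.
rewrite (bigID (fun x : {ffun 'I_k -> 'I_n.+2} => val (x i) == 0%N))/= big1 ?add0r.
  rewrite /H mulr_sumr.
  pose h (x : {ffun 'I_k -> 'I_n.+1}) : {ffun 'I_k -> 'I_n.+2} :=
    [ffun j => inord (x j + (j == i))].
  pose h' (x : {ffun 'I_k -> 'I_n.+2}) : {ffun 'I_k -> 'I_n.+1} :=
    [ffun j => inord (x j - (j == i))].
  have hE (x : {ffun 'I_k -> 'I_n.+1}) j : (h x j = x j + (j == i) :> nat)%N.
    rewrite ffunE inordK//; apply: (@leq_ltn_trans (x j).+1).
      by case: (j == i); rewrite ?addn1// addn0.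
    by rewrite ltnS ltn_ord.
  rewrite (reindex_onto h h'); last first.
    move=> x /andP[xn xi]; apply/ffunP => j; apply/val_inj.
    rewrite /= hE ffunE inordK; last first.
      have [->|ji] := eqVneq j i.
        by rewrite ltnS leq_subLR add1n -ltnS ltn_ord.
      rewrite subn0; have := le_total2 ji xn.
      apply: leq_trans; move: xi; rewrite -lt0n => xi.
      by rewrite -add1n leq_add2r.
    rewrite subnK//; have [->|//] := eqVneq j i.
    by rewrite lt0n.
  apply: eq_big => [x|x].
    rewrite (eq_bigr (fun j => x j + (j == i))%N); last by move=> j _.
    rewrite shift_total eqSS hE eqxx addn1/= andbT.
    case: eqVneq => //= _; apply/eqP/ffunP => j; apply/val_inj.
    by rewrite /= ffunE hE addnK inordK.
  move=> _; rewrite [RHS]mulrA -(multinom_shift n _ i).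
  rewrite (_ : (fun j => nat_of_ord (h x j)) = (fun j => x j + (j == i))%N);
    last by apply/funext => j; rewrite hE.
  rewrite -mulrA; congr (_ * _).
  rewrite [in RHS](bigD1 i)//= hE eqxx addn1/=.
  rewrite -mulr_natl -mulrA; congr (_ * (_ ^+ _ * _)).
    by rewrite -natr1; ring.
  by apply: eq_bigr => j ji; rewrite hE (negbTE ji) addn0 mulr0 addr0.
by move=> x /andP[_ /eqP->]; rewrite mulr0n mul0r mulr0.
Qed.

Local Lemma deriv_prod k (F : 'I_k -> {poly R}) :
  (\prod_i F i)^`() = \sum_i (F i)^`() * \prod_(j | j != i) F j.
Proof.
elim: k F => [F|k IH F]; first by rewrite !big_ord0 derivC.
rewrite big_ord_recl derivM IH [RHS]big_ord_recl; congr (_ * _ + _).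
  by rewrite [RHS]big_mkcond/= big_ord_recl eqxx mul1r; apply: eq_bigr.
rewrite mulr_sumr; apply: eq_bigr => i _.
rewrite [in RHS]big_mkcond/= big_ord_recl/= mulrCA; congr (_ * (_ * _)).
by rewrite [LHS]big_mkcond.
Qed.

Local Lemma poly_eval0 (q : {poly R}) : (forall s, q.[s] = 0) -> q = 0.
Proof.
move=> q0; apply/eqP/negPn/negP => q_neq0.
have := @max_poly_roots _ q [seq i%:R | i <- iota 0 (size q)] q_neq0.
rewrite size_map size_iota ltnn => h.
suff : false by []; apply: h; first by apply/allP => x _; rewrite rootE q0.
by rewrite map_inj_uniq ?iota_uniq//; exact: mulrIn (oner_neq0 R).
Qed.

Local Lemma H_indep k n (a : R) (y z : 'I_k -> R) :
  \sum_i y i = \sum_i z i -> H n a y = H n a z.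
Proof.
elim: n y z => [|n IH] y z yz.
  apply: eq_bigr => x /eqP x0; congr (_ * _); apply: eq_bigr => i _.
  by have := ltn_ord (x i); rewrite ltnS leqn0 => /eqP ->.
pose Q : {poly R} := \sum_(x : {ffun 'I_k -> 'I_n.+2} | (\sum_i x i == n.+1)%N)
  multinom R n.+1 (fun i => x i) *:
    \prod_i ((a * (x i)%:R + y i)%:P + (z i - y i) *: 'X) ^+ x i.
have QE s : Q.[s] = H n.+1 a (fun i => y i + s * (z i - y i)).
  rewrite horner_sum; apply: eq_bigr => x _; rewrite hornerZ horner_prod.
  congr (_ * _); apply: eq_bigr => i _; rewrite horner_exp !hornerE.
  by congr (_ ^+ _); rewrite [s * _]mulrC.
have Q'0 : Q^`() = 0.
  apply: poly_eval0 => s.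
  pose ys i := y i + s * (z i - y i).
  transitivity (\sum_i (z i - y i) *
      (n.+1%:R * H n a (fun j => ys j + a * (j == i)%:R))).
    under eq_bigr do rewrite -H_shift mulr_sumr.
    rewrite exchange_big/= {1}/Q linear_sum horner_sum; apply: eq_bigr => x _/=.
    rewrite derivZ hornerZ deriv_prod horner_sum mulr_sumr.
    apply: eq_bigr => i _; rewrite hornerM horner_prod [RHS]mulrCA; congr (_ * _).
    rewrite [RHS]mulrA; congr (_ * _).
      rewrite deriv_exp derivD derivC derivZ derivX hornerMn hornerM horner_exp !hornerE/=.
      rewrite -mulrnAr; congr (_ * (_ ^+ _ *+ _)).
      by rewrite [s * _]mulrC.
    apply: eq_bigr => j _; rewrite horner_exp !hornerE; congr (_ ^+ _).
    by rewrite [s * _]mulrC.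
  have [i0 _|no] := pickP (fun _ : 'I_k => true); last first.
    by rewrite big1// => i; have := no i.
  rewrite (eq_bigr (fun i => (z i - y i) *
      (n.+1%:R * H n a (fun j => ys j + a * (j == i0)%:R)))); last first.
    move=> i _; congr (_ * (_ * _)); apply: IH.
    rewrite !big_split/=; congr (_ + _); rewrite -!mulr_sumr; congr (_ * _).
    by rewrite (bigD1 i)//= [in RHS](bigD1 i0)//= !eqxx !big1// => j /negbTE ->.
  by rewrite -mulr_suml sumrB yz subrr mul0r.
have QC : Q = (Q`_0)%:P.
  apply/polyP => -[|i]; rewrite coefC//=.
  have : Q^`()`_i = 0 by rewrite Q'0 coef0.
  by rewrite coef_deriv => /eqP; rewrite mulrn_eq0/= => /eqP.
transitivity Q.[0].
  by rewrite QE; congr H; apply/funext => i; ring.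
transitivity Q.[1]; first by rewrite QC !hornerC.
by rewrite QE; congr H; apply/funext => i; ring.
Qed.

Local Lemma Gsum_H k n lam (p : 'I_k -> R) :
  Gsum n lam p = H n (lam / n%:R) (fun i => (1 - lam) * p i).
Proof.
apply: eq_bigr => x _; congr (_ * _); apply: eq_bigr => i _.
by congr (_ ^+ _); rewrite -mulrA [_^-1 * _]mulrC.
Qed.

Lemma simplex_uniform k : (1 <= k)%N -> simplex (fun _ : 'I_k => k%:R^-1 : R).
Proof.
move=> k1; split=> [i|]; first by rewrite invr_ge0.
by rewrite sumr_const card_ord -[_ *+ _]mulr_natl mulfV// pnatr_eq0 -lt0n.
Qed.

Lemma GsumE k n lam (p : 'I_k -> R) : (1 <= k)%N -> simplex p ->
  Gsum n lam p = G k n lam.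
Proof.
move=> k1 [_ p1]; have [_ u1] := simplex_uniform k1.
rewrite /G !Gsum_H; apply: H_indep.
by rewrite -!mulr_sumr p1 u1.
Qed.

End GsumE.

(* Main.v *)
Require Import Defs.
From mathcomp Require Import all_boot all_order all_algebra.
From mathcomp Require Import all_classical all_reals all_analysis.
From mathcomp Require Import ring.
Import Order.TTheory GRing.Theory Num.Theory.
Import numFieldNormedType.Exports.
Local Open Scope classical_set_scope.
Local Open Scope ring_scope.

(** For a single lambda the bound is an exponential-tilting argument made
    termwise.  Fix counts x with total n and q = x / n.  When q is absolutely
    continuous with respect to p, the multinomial probability of x, tilted by
    exp (lambda n D(q || p)), has i-th factor
    (p_i^(1 - lambda) q_i^lambda)^(x_i); by weighted AM-GM this is at most
    (lambda q_i + (1 - lambda) p_i)^(x_i), the factor of x in the sum defining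
    G ([expR_interp_le]).  So on the event n D > t the probability of x is at
    most exp (- lambda t) times the term of x in G ([pmf_tilt_le]); when q is
    not absolutely continuous, D = +oo but x has probability 0.  Summing over
    the x in the event, and adding the other terms of G, which are nonnegative,
    gives the bound, as G may be computed with any p in the simplex ([GsumE]).

    Two points complete the argument.  The law of X is given only through its
    point masses, so the event is first written as a countable union of fibers
    of X; those of total other than n are null, and finitely many remain
    ([multinomial_event_le]).  And lambda |-> exp (- lambda t) G(lambda) is
    continuous, G being polynomial ([Gsum_poly]), so it has a minimizer on
    [0, 1], to which the bound is applied. *)

(** Weighted AM-GM, q^lam p^(1 - lam) <= lam q + (1 - lam) p, with the left
    side written relative to p so that products over outcomes produce the
    relative entropy in the exponent. *)
Lemma expR_interp_le (R : realType) (lam q p : R) : 0 <= lam <= 1 ->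
  0 < q -> 0 < p -> p * expR (lam * ln (q / p)) <= lam * q + (1 - lam) * p.
Proof.
move=> lam01 q0 p0.
have := convex_expR (Itv01 (andP lam01).1 (andP lam01).2) (ln q) (ln p).
rewrite !convRE !lnK// => /(le_trans _); apply.
rewrite -{1}(lnK p0) -expRD ler_expR ln_div//= /unstable.onem.
rewrite (_ : ln p + _ = lam * ln q + (1 - lam) * ln p)//; ring.
Qed.

Lemma tilted_term_ge0 (R : realType) (k n : nat) (p : 'I_k -> R)
    (x : 'I_k -> nat) (lam : R) : (forall i, 0 <= p i) -> 0 <= lam <= 1 ->
  0 <= multinom R n x *
       \prod_i (lam * ((x i)%:R / n%:R) + (1 - lam) * p i) ^+ x i.
Proof.
move=> p0 /andP[l0 l1]; rewrite mulr_ge0//; first by rewrite divr_ge0// prodr_ge0.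
rewrite prodr_ge0// => i _.
by rewrite exprn_ge0// addr_ge0// mulr_ge0// ?divr_ge0// subr_ge0.
Qed.

(** Markov's inequality for exp (lam n D), one outcome at a time: the tilt is
    at least exp (lam t) on the tail event, and the tilted probability is
    bounded factor by factor by weighted AM-GM. *)
Lemma pmf_tilt_le (R : realType) (k n : nat) (p : 'I_k -> R) (x : 'I_k -> nat)
    (lam t : R) : (0 < n)%N -> (forall i, 0 <= p i) -> 0 <= lam <= 1 ->
  (\sum_i x i = n)%N ->
  (t%:E < n%:R%:E * rel_entropy (empirical R n x) p)%E ->
  multinomial_pmf n p x <= expR (- lam * t) *
    (multinom R n x *
     \prod_i (lam * ((x i)%:R / n%:R) + (1 - lam) * p i) ^+ x i).
Proof.
move=> n0 p0 lam01 xn tD; have /andP[l0 l1] := lam01.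
have nR0 : 0 < n%:R :> R by rewrite ltr0n.
have m0 : 0 <= multinom R n x by rewrite divr_ge0// prodr_ge0.
rewrite /multinomial_pmf xn eqxx.
have [/existsP[i /andP[xi0 pi0]]|/existsPn supp] :=
    boolP [exists i, (x i != 0%N) && (p i == 0)].
  (* Here D is +oo, but x has probability zero. *)
  rewrite (bigD1 i)//= (eqP pi0) expr0n (negbTE xi0) mul0r mulr0.
  by rewrite mulr_ge0 ?expR_ge0// tilted_term_ge0.
have {}supp i : x i != 0%N -> 0 < p i.
  by move=> xi0; move: (supp i); rewrite xi0 lt_def p0 andbT.
(* The factor (x i)%:R = 0 absorbs the junk value of ln when x i = 0, so the
   entropy is this finite sum without a case distinction. *)
pose s i : R := (x i)%:R * ln ((x i)%:R / n%:R / p i).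
have DE : (n%:R%:E * rel_entropy (empirical R n x) p = (\sum_i s i)%:E)%E.
  rewrite /rel_entropy (eq_bigr (fun i => (n%:R^-1 * s i)%:E)); last first.
    move=> i _; rewrite rel_entropy_term//; last by rewrite divr_ge0.
    rewrite /empirical /s; have [->|xi0] := eqVneq (x i) 0%N.
      by rewrite !mul0r eqxx mulr0.
    rewrite mulf_eq0 invr_eq0 !pnatr_eq0 (negbTE xi0) (gtn_eqF n0)/=.
    by rewrite gt_eqF ?supp// mulrA [_^-1 * _]mulrC.
  by rewrite sumEFin -EFinM -mulr_sumr mulrA mulfV ?mul1r// gt_eqF.
rewrite DE lte_fin in tD.
rewrite mulrCA ler_wpM2l//.
apply: (@le_trans _ _ (expR (- lam * t) *
    (\prod_i p i ^+ x i * expR (lam * \sum_i s i)))).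
  rewrite mulrCA -expRD ler_peMr//.
    by rewrite prodr_ge0// => i _; exact: exprn_ge0.
  by rewrite -expR0 ler_expR mulNr addrC subr_ge0 ler_wpM2l// ltW.
rewrite ler_wpM2l ?expR_ge0// mulr_sumr expR_sum -big_split/=.
apply: ler_prod => i _; rewrite mulr_ge0 ?expR_ge0 ?exprn_ge0//=.
have [xi0|xi0] := eqVneq (x i) 0%N.
  by rewrite /s xi0 !expr0 mul0r mulr0 expR0 mulr1.
rewrite /s mulrCA expRM_natl -exprMn lerXn2r ?nnegrE//.
- by rewrite mulr_ge0 ?expR_ge0.
- by rewrite addr_ge0// mulr_ge0// ?divr_ge0// subr_ge0.
by rewrite expR_interp_le// ?supp// divr_gt0// ltr0n lt0n.
Qed.

Section vector_event.
Context d (T : measurableType d) (R : realType) (P : probability T R) (k : nat).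
Variable X : 'I_k -> {RV P >-> nat}.

Lemma measurable_fiber (x : 'I_k -> nat) :
  measurable [set w | forall i, X i w = x i].
Proof.
rewrite (_ : mkset _ = \bigcap_(i in [set: 'I_k]) (X i @^-1` [set x i])).
  apply: fin_bigcap_measurable => // i _.
  by rewrite -[X in measurable X]setTI; exact: measurable_funP.
by apply/seteqP; split=> [w xw i _|w xw i]; exact: xw.
Qed.

(** Vectors of naturals form a countable type, so every event on X, whatever
    the predicate Q, is a countable union of fibers; the union is indexed by
    the codes of the vectors because countable additivity is stated for
    sequences. *)
Lemma vector_event_bigcup (Q : set ('I_k -> nat)) :
  [set w | Q (fun i => X i w)] =
  \bigcup_m (if unpickle m is Some x then
     if `[< Q (x : {ffun 'I_k -> nat}) >] then [set w | forall i, X i w = x i]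
     else set0 else set0).
Proof.
apply/seteqP; split=> w /=.
  move=> Qw; exists (pickle [ffun i => X i w : nat]) => //=.
  rewrite pickleK; case: asboolP => [_ i|]; first by rewrite ffunE.
  by case; congr Q : Qw; apply/funext => i; rewrite ffunE.
move=> [m _]; case: unpickle => // x; case: asboolP => // Qx xw.
by congr Q : Qx; apply/funext => i; rewrite xw.
Qed.

Lemma measurable_vector_event (Q : set ('I_k -> nat)) :
  measurable [set w | Q (fun i => X i w)].
Proof.
rewrite vector_event_bigcup; apply: bigcupT_measurable => m.
by case: unpickle => // x; case: ifP => // _; exact: measurable_fiber.
Qed.

Lemma vector_event_null (Q : set ('I_k -> nat)) :
  (forall x, Q x -> P [set w | forall i, X i w = x i] = 0%E) ->
  P [set w | Q (fun i => X i w)] = 0%E.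
Proof.
move=> Q0; apply: measure_negligible; first exact: measurable_vector_event.
rewrite vector_event_bigcup; apply: negligible_bigcup => m.
case: unpickle => [x|]; last exact: negligible_set0.
case: asboolP => [Qx|_]; last exact: negligible_set0.
by apply/negligibleP; [exact: measurable_fiber|exact: Q0].
Qed.

(** Point masses bound the probability of every event: vectors of total other
    than n carry no mass, and the remaining ones have entries at most n, hence
    the finite index type of the sum. *)
Lemma multinomial_event_le (n : nat) (p : 'I_k -> R) (Q : set ('I_k -> nat)) :
  is_multinomial n p X ->
  (P [set w | Q (fun i => X i w)] <=
   (\sum_(x : {ffun 'I_k -> 'I_n.+1} |
      (\sum_i x i == n)%N && `[< Q (fun i => x i) >])
      multinomial_pmf n p (fun i => x i))%:E)%E.
Proof.
move=> hX.
pose good (x : {ffun 'I_k -> 'I_n.+1}) :=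
  (\sum_i x i == n)%N && `[< Q (fun i => x i) >].
pose fiber (x : 'I_k -> nat) := [set w | forall i, X i w = x i].
pose E := \bigcup_(x in [set` good]) fiber (fun i => x i).
have mE : measurable E.
  by apply: fin_bigcup_measurable => // x _; exact: measurable_fiber.
pose off (x : 'I_k -> nat) : Prop := (\sum_i x i)%N <> n.
pose N := [set w | off (fun i => X i w)].
have N0 : P N = 0%E.
  apply: (@vector_event_null off) => x /eqP xn.
  by rewrite hX /multinomial_pmf (negbTE xn).
apply: (@le_trans _ _ (P (E `|` N))).
  rewrite le_measure ?inE//; first exact: measurable_vector_event.
    by apply: measurableU => //; exact: (measurable_vector_event off).
  move=> w /= Qw; have [Xn|] := pselect ((\sum_i X i w)%N = n); last by right.
  have Xle i : (X i w < n.+1)%N by rewrite ltnS -Xn (bigD1 i)//= leq_addr.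
  left; exists [ffun i => Ordinal (Xle i)]; last by move=> i; rewrite ffunE.
  apply/andP; split.
    by apply/eqP; rewrite -[RHS]Xn; apply: eq_bigr => i _; rewrite ffunE.
  by apply/asboolP; congr Q : Qw; apply/funext => i; rewrite ffunE.
rewrite measureU0//; last exact: (measurable_vector_event off).
apply: (@le_trans _ _ (\sum_(x \in [set` good]) P (fiber (fun i => x i)))%E).
  by apply: content_sub_fsum => // x _; exact: measurable_fiber.
rewrite -(@bigfs _ _ _ _ (index_enum _)) ?index_enum_uniq//; last first.
  by move=> x _; rewrite mem_index_enum.
by rewrite -sumEFin (eq_bigr _ (fun x _ => hX _)).
Qed.

End vector_event.

Lemma Gsum_poly (R : realType) (k n : nat) (p : 'I_k -> R) :
  exists g : {poly R}, forall lam, Gsum n lam p = g.[lam].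
Proof.
exists (\sum_(x : {ffun 'I_k -> 'I_n.+1} | (\sum_i x i == n)%N)
  multinom R n (fun i => x i) *:
  \prod_i ('X * ((x i)%:R / n%:R)%:P + (1 - 'X) * (p i)%:P) ^+ x i) => lam.
rewrite horner_sum; apply: eq_bigr => x _; rewrite hornerZ horner_prod.
by congr (_ * _); apply: eq_bigr => i _; rewrite horner_exp !hornerE.
Qed.

Theorem theorem2 (R : realType) (k n : nat) (hk : (2 <= k)%N) (hn : (1 <= n)%N)
    (p : 'I_k -> R) (hp : simplex p)
    (d : measure_display) (T : measurableType d) (P : probability T R)
    (X : 'I_k -> {RV P >-> nat}) (hX : is_multinomial n p X)
    (t : R) (ht : 0 < t) :
  exists m : R,
    [/\ [set expR (- lam * t) * G k n lam | lam in `[0, 1] ] m,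
        lbound [set expR (- lam * t) * G k n lam | lam in `[0, 1] ] m &
        (P [set w | t%:E < n%:R%:E * rel_entropy (empirical R n (fun i => X i w)) p]
           <= m%:E)%E].
Proof.
have k1 : (1 <= k)%N by exact: ltnW.
have [g gE] := Gsum_poly R k n (fun _ => k%:R^-1).
have cf : continuous (fun lam : R => expR (- lam * t) * G k n lam).
  have -> : G k n = horner g by apply/funext => lam; exact: gE.
  move=> lam; apply: cvgM; last exact: continuous_horner.
  apply: (@continuous_comp _ _ _ (fun u : R => - u * t) expR); last exact: continuous_expR.
  by apply: cvgM; [exact: cvgN|exact: cvg_cst].
have [lam lam01 lam_min] := EVT_min ler01 (continuous_subspaceT cf).
exists (expR (- lam * t) * G k n lam); split; first by exists lam.
  by move=> _ [u u01 <-]; exact: lam_min.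
rewrite in_itv/= in lam01; have /andP[l0 l1] := lam01.
pose tail (x : 'I_k -> nat) : Prop :=
  (t%:E < n%:R%:E * rel_entropy (empirical R n x) p)%E.
apply: le_trans (@multinomial_event_le _ _ _ _ _ _ _ _ tail hX) _.
rewrite lee_fin -(GsumE n lam k1 hp) mulr_sumr big_mkcondr/=.
apply: ler_sum => x /eqP xn; case: asboolP => [tD|_].
  by apply: pmf_tilt_le => //; exact: hp.1.
by rewrite mulr_ge0 ?expR_ge0// tilted_term_ge0//; exact: hp.1.
Qed.
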